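(* Let $L$ be a positive-definite even lattice and $M\le L$ an abelian submonoid. Then $N_{V_L}(V_M)=V_M$. In particular, for any parabolic-type submonoid $P\le L$, $N_{V_L}(V_P)=V_P$.
   Context: $L$ is spanned over $\mathbb{Z}$ by an $\mathbb{R}$-basis of a Euclidean space $(E,(\cdot|\cdot))$. A submonoid of $L$ is a subset containing $0$ and closed under addition. A submonoid $B\le L$ is of Borel-type if $B\cup(-B)=L$, $B\cap(-B)=\{0\}$, and there is $0\ne\gamma\in E$ with $(\gamma|b)\ge0$ for all $b\in B$. A submonoid $P\le L$ is of parabolic-type if it contains a Borel-type submonoid. Lattice VOA. Put $\mathfrak{h}=\mathbb{C}\otimes_{\mathbb{Z}}L$ with the $\mathbb{C}$-bilinear extension of $(\cdot|\cdot)$, and $\hat{\mathfrak{h}}=\mathfrak{h}\otimes\mathbb{C}[t,t^{-1}]\oplus\mathbb{C}K$ with $K$ central, $h(m)=h\otimes t^m$, $[h_1(m),h_2(n)]=m\delta_{m+n,0}(h_1|h_2)K$. For $\lambda\in\mathfrak{h}$, $M_{\hat{\mathfrak{h}}}(1,\lambda)=U(\hat{\mathfrak{h}})\otimes_{U(\hat{\mathfrak{h}}_{\ge 0})}\mathbb{C}e^\lambda$, where $\hat{\mathfrak{h}}_{\ge 0}=\mathfrak{h}\otimes\mathbb{C}[t]\oplus\mathbb{C}K$ acts by $K=1$, $h(0)e^\lambda=(h|\lambda)e^\lambda$, $h(n)e^\lambda=0$ for $n>0$. Let $\epsilon:L\times L\to\{\pm1\}$ be a 2-cocycle with $\epsilon(\alpha,\beta)\epsilon(\beta,\alpha)=(-1)^{(\alpha|\beta)}$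 and $\epsilon(0,\alpha)=\epsilon(\alpha,0)=1$. The lattice VOA is $V_L=\bigoplus_{\alpha\in L}M_{\hat{\mathfrak{h}}}(1,\alpha)=M_{\hat{\mathfrak{h}}}(1,0)\otimes\mathbb{C}^\epsilon[L]$ with vacuum $\mathbf{1}=e^0$, $Y(h(-1)\mathbf{1},z)=\sum_{n}h(n)z^{-n-1}$, $Y(e^\alpha,z)=\exp\big(\sum_{n>0}\frac{\alpha(-n)}{n}z^n\big)\exp\big(-\sum_{n>0}\frac{\alpha(n)}{n}z^{-n}\big)e_\alpha z^\alpha$, where $e_\alpha(w\otimes e^\beta)=\epsilon(\alpha,\beta)w\otimes e^{\alpha+\beta}$ and $z^\alpha$ acts on $M_{\hat{\mathfrak{h}}}(1,\beta)$ as $z^{(\alpha|\beta)}$; $Y$ of a general $h_1(-n_1-1)\cdots h_k(-n_k-1)e^\alpha$ is the normally ordered product of the $\frac{1}{n_i!}\partial_z^{n_i}h_i(z)$ and $Y(e^\alpha,z)$. For a submonoid $M\le L$, $V_M=\bigoplus_{\gamma\in M}M_{\hat{\mathfrak{h}}}(1,\gamma)$ is a subVOA of $V_L$. Normalizer. For a VOA $V$ and a sub-vertex algebra (possibly without vacuum) $W\le V$, with $Y(a,z)=\sum_n a_nz^{-n-1}$, $N_V(W)=\{a\in V: a_jW\subseteq W\text{ for all }j\ge0\}$. *)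

(* Defs.v *)
From HB Require Import structures.
From mathcomp Require Import all_boot all_order all_algebra.
From mathcomp Require Import finmap.
From mathcomp.multinomials Require Import monalg.
From mathcomp Require Import complex.
From mathcomp Require Import boolp classical_sets functions cardinality fsbigop.
From mathcomp Require Import reals.

Set Implicit Arguments.
Unset Strict Implicit.
Unset Printing Implicit Defensive.

Import Order.TTheory GRing.Theory Num.Theory.

Local Open Scope complex_scope.
Local Open Scope classical_set_scope.
Local Open Scope ring_scope.

Record euclideanLattice (R : realType) := EuclideanLattice {
  ambient : vectType R;
  edot : {dot ambient for idfun};
  lrank : nat;
  lbasis : lrank.-tuple ambient;
  lbasisP : basis_of fullv lbasis }.

(* The lattice spanned over Z by the basis is handled through its integer
   coordinates; lvec is the inclusion of the lattice in the Euclidean space. *)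
Definition lat (R : realType) (L : euclideanLattice R) : zmodType :=
  'rV[int]_(lrank L).

Coercion lat : euclideanLattice >-> GRing.Zmodule.type.

(* The vector space {malg F[K]} with basis K, as an opaque copy: unification
   must not unfold the finite maps behind {malg F[K]}. *)
Record freeModule (F : fieldType) (K : choiceType) := FreeModule {
  free_mod : lmodType F;
  to_malg : {linear free_mod -> {malg F[K]}};
  to_malg_bij : bijective to_malg;
  free_vec : K -> free_mod;
  to_malg_vec : forall x, to_malg (free_vec x) = << x >> }.

Lemma free_module (F : fieldType) (K : choiceType) : freeModule F K.
Proof.
by apply: (@FreeModule F K {malg F[K]} idfun _ (fun x => << x >>)); first exists id.
Qed.

Definition Cplx (R : realType) : numClosedFieldType := R[i].

Definition toC (R : realType) : {rmorphism R -> Cplx R} := real_complex R.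

Section Lattice.
Context (R : realType) (L : euclideanLattice R).

Definition lvec (a : L) : ambient L :=
  \sum_(i < lrank L) ((a : 'rV[int]_(lrank L)) 0 i)%:~R *: (lbasis L)`_i.

Definition ldot (a b : L) : R := edot L (lvec a) (lvec b).

Definition even_lattice : Prop :=
  forall a : L, exists k : int, ldot a a = (2 * k)%:~R.

Definition submonoid (M : set L) : Prop :=
  M 0 /\ forall a b, M a -> M b -> M (a + b).

Definition borel_type (B : set L) : Prop :=
  [/\ submonoid B,
      B `|` [set - b | b in B] = setT,
      B `&` [set - b | b in B] = [set 0]
    & exists2 g : ambient L, g != 0 & forall b, B b -> 0 <= edot L g (lvec b)].

Definition parabolic_type (P : set L) : Prop :=
  submonoid P /\ exists2 B, borel_type B & B `<=` P.

Record sign_cocycle (eps : L -> L -> int) : Prop := SignCocycle {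
  sign_cocycle_pm1 : forall a b, eps a b = 1 \/ eps a b = -1;
  sign_cocycleP : forall a b c,
    eps a b * eps (a + b) c = eps b c * eps a (b + c);
  sign_cocycle_comm : forall (a b : L) (k : int),
    ldot a b = k%:~R -> eps a b * eps b a = (-1) ^ k;
  sign_cocycle0l : forall a, eps 0 a = 1;
  sign_cocycle0r : forall a, eps a 0 = 1 }.

Local Notation C := (Cplx R).

(* C (x)_Z L, in coordinates with respect to the Z-basis of L. *)
Definition cartan : lmodType C := 'rV[C]_(lrank L).

Definition cdot (h k : cartan) : C :=
  \sum_i \sum_j (h : 'rV_(lrank L)) 0 i * (k : 'rV_(lrank L)) 0 j
    * toC R (edot L (lbasis L)`_i (lbasis L)`_j).

Definition cartan_of_lat (a : L) : cartan :=
  map_mx intr (a : 'rV[int]_(lrank L)) : 'rV[C]_(lrank L).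

Definition cartan_basis (i : 'I_(lrank L)) : cartan :=
  delta_mx 0 i : 'rV[C]_(lrank L).

(* PBW basis: the pair (u, a), with u a multiset of indices (i, k), stands for
   the product of the b_i(-k-1), (i, k) in u, applied to e^a; here b_i is the
   i-th vector of the basis of L.  The vectors with second component a span
   the induced module M(1, a): see heis_comm, heis0_expL, heis_pos_expL and
   fock_universal. *)
Definition pbw : choiceType := ({cmonom ('I_(lrank L) * nat)} * L)%type.

Definition VL : lmodType C := free_mod (free_module C pbw).

Definition vmalg (v : VL) : {malg C[pbw]} := to_malg (free_module C pbw) v.

Definition bvec (x : pbw) : VL := free_vec (free_module C pbw) x.

Definition linext (f : pbw -> VL) (v : VL) : VL :=
  \sum_(x <- msupp (vmalg v)) mcoeff x (vmalg v) *: f x.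

Definition expL (a : L) : VL := bvec (mone, a).

Definition vac : VL := expL 0.

Definition create (ik : 'I_(lrank L) * nat) : VL -> VL :=
  linext (fun x => bvec (mmul (ucm ik) x.1, x.2)).

Definition annihilate (ik : 'I_(lrank L) * nat) : VL -> VL :=
  linext (fun x => (x.1 ik)%:R *: bvec (divcm x.1 (ucm ik), x.2)).

(* The operator h(m) of the Heisenberg algebra, with K acting as 1. *)
Definition heis (h : cartan) (m : int) (v : VL) : VL :=
  match m with
  | Posz 0 => linext (fun x => cdot h (cartan_of_lat x.2) *: bvec x) v
  | Posz k.+1 =>
      \sum_i (k.+1%:R * cdot h (cartan_basis i)) *: annihilate (i, k) v
  | Negz k => \sum_i (h : 'rV_(lrank L)) 0 i *: create (i, k) v
  end.

(* [A n] is the coefficient of z^(-n-1) of the field A. *)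
Definition vfield := int -> VL -> VL.

Definition dfield (A : vfield) : vfield := fun n v => (- n)%:~R *: A (n - 1) v.

Definition divided_dfield (k : nat) (A : vfield) : vfield :=
  fun n v => (k`!%:R : C)^-1 *: iter k dfield A n v.

(* A(z)_- B(z) + B(z) A(z)_+, with A(z)_+ the part of negative powers of z.
   On each vector, for the fields below, only finitely many summands are not 0;
   \sum_(i \in A) sums these. *)
Definition nop (A B : vfield) : vfield := fun n v =>
  \sum_(m \in [set m : int | m < 0]) A m (B (n - m - 1) v)
  + \sum_(m \in [set m : int | 0 <= m]) B (n - m - 1) (A m v).

(* Power series with operator coefficients. *)
Definition opser := nat -> VL -> VL.

Definition opser1 : opser := fun k v => if k is 0 then v else 0.

Definition opserM (A B : opser) : opser :=
  fun k v => \sum_(i < k.+1) A i (B (k - i)%N v).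

(* For A with zero constant term, the j-th power of A does not contribute to
   the k-th coefficient when k < j. *)
Definition opser_exp (A : opser) : opser := fun k v =>
  \sum_(j < k.+1) (j`!%:R : C)^-1 *: iter j (opserM A) opser1 k v.

(* Series in z. *)
Definition exp_minus (a : L) : opser := opser_exp (fun n v =>
  if n is 0 then 0 else (n%:R : C)^-1 *: heis (cartan_of_lat a) (- n%:Z) v).

(* Series in z^-1. *)
Definition exp_plus (a : L) : opser := opser_exp (fun n v =>
  if n is 0 then 0 else - (n%:R : C)^-1 *: heis (cartan_of_lat a) n v).

(* The coefficient of z^k in the operator z^a. *)
Definition zpow (a : L) (k : int) : VL -> VL :=
  linext (fun x => if ldot a x.2 == k%:~R then bvec x else 0).

Definition heis_field (h : cartan) : vfield := fun n v => heis h n v.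

Section VertexOperators.
Context (eps : L -> L -> int).

Definition translate (a : L) : VL -> VL :=
  linext (fun x => (eps a x.2)%:~R *: bvec (x.1, a + x.2)).

(* The sum ranges over the contributions z^p z^-q z^k to z^(-n-1). *)
Definition Yexp (a : L) : vfield := fun n v =>
  \sum_(t \in [set t : nat * nat * int |
               let: (p, q, k) := t in p%:Z - q%:Z + k = - n - 1])
    let: (p, q, k) := t in
    exp_minus a p (exp_plus a q (translate a (zpow a k v))).

(* The normally ordered product of the fields (1/k!) d^k b_i(z), for (i, k) in
   the multiset x.1, and of Y(e^(x.2), z).  The order of the factors is
   irrelevant, as the creation (annihilation) modes commute. *)
Definition Ypbw (x : pbw) : vfield :=
  foldr (fun ik B => iter (x.1 ik)
           (nop (divided_dfield ik.2 (heis_field (cartan_basis ik.1)))) B)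
    (Yexp x.2) (finsupp x.1).

(* [Y a n] is the n-th mode a_n. *)
Definition Y (a : VL) (n : int) (v : VL) : VL :=
  \sum_(x <- msupp (vmalg a)) mcoeff x (vmalg a) *: Ypbw x n v.

End VertexOperators.

Definition VM (M : set L) : set VL :=
  [set v | forall x, x \in msupp (vmalg v) -> M x.2].

End Lattice.

Definition normalizer (V : Type) (Y : V -> int -> V -> V) (W : set V) : set V :=
  [set a | forall (j : nat) (w : V), W w -> W (Y a j w)].

Section MultisetAction.
Context (I : choiceType) (T : Type) (op : I -> T -> T) (P : T -> Prop).
Context (opP : forall i t, P t -> P (op i t)).
Context (opC : forall i j t, P t -> op i (op j t) = op j (op i t)).

Let act (u : {cmonom I}) (s : seq I) (t : T) : T :=
  foldr (fun i => iter (u i) (op i)) t s.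

Let iterP i k t : P t -> P (iter k (op i) t).
Proof. by move=> Pt; elim: k => //= k; exact: opP. Qed.

Let actP u s t : P t -> P (act u s t).
Proof. by move=> Pt; elim: s => //= i s; exact: iterP. Qed.

Let iterC i j k t : P t -> iter k (op i) (op j t) = op j (iter k (op i) t).
Proof. by move=> Pt; elim: k => //= k ->; rewrite opC //; exact: iterP. Qed.

Let iter_iterC i j k l t : P t ->
  iter k (op i) (iter l (op j) t) = iter l (op j) (iter k (op i) t).
Proof.
move=> Pt; elim: l => //= l IH; rewrite iterC ?IH //; exact: iterP.
Qed.

Let act_iterC u i s k t : P t -> iter k (op i) (act u s t) = act u s (iter k (op i) t).
Proof.
by move=> Pt; elim: s => //= j s IH; rewrite iter_iterC ?IH //; exact: actP.
Qed.

Let act_cat u s1 s2 t : act u (s1 ++ s2) t = act u s1 (act u s2 t).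
Proof. by rewrite /act foldr_cat. Qed.

Let actC u s1 s2 t : P t -> act u s1 (act u s2 t) = act u s2 (act u s1 t).
Proof.
move=> Pt; elim: s1 => //= i s1 ->; rewrite act_iterC //; exact: actP.
Qed.

Let act_perm u s1 s2 t : P t -> perm_eq s1 s2 -> act u s1 t = act u s2 t.
Proof.
move=> Pt s12; apply: (catCA_perm_ind (P := fun s => act u s1 t = act u s t)) s12 _ => //.
move=> r1 r2 r3 ->; rewrite !act_cat actC //; exact: actP.
Qed.

Let eq_act (u v : {cmonom I}) s t : (forall i, i \in s -> u i = v i) -> act u s t = act v s t.
Proof.
elim: s => //= i s IH uv; rewrite IH ?uv ?mem_head // => j js.
by apply: uv; rewrite inE js orbT.
Qed.

Let act_ucm u i s t : P t -> uniq s -> i \in s ->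
  act (mmul (ucm i) u) s t = op i (act u s t).
Proof.
move=> Pt; elim: s => //= j s IH /andP[js us]; rewrite inE cmM cmU.
have [ij _|ij /= /IH -> //] := eqVneq i j; first subst j.
  rewrite add1n /=; congr (op i (iter _ _ _)); apply: eq_act => k ks.
  rewrite cmM cmU; have [ik|_] := eqVneq i k; last by [].
  by rewrite ik ks in js.
by rewrite add0n iterC //; exact: actP.
Qed.

Lemma foldr_finsupp_ucm u i t : P t ->
  foldr (fun j => iter (mmul (ucm i) u j) (op j)) t (finsupp (mmul (ucm i) u)) =
  op i (foldr (fun j => iter (u j) (op j)) t (finsupp u)).
Proof.
move=> Pt; rewrite -!/(act _ _ _) act_ucm ?fset_uniq //; last first.
  by rewrite mdomD mdomU !inE eqxx.
congr (op i _); rewrite mdomD mdomU.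
have [iu|iu] := boolP (i \in finsupp u).
  apply: act_perm => //; apply: uniq_perm; rewrite ?fset_uniq // => j.
  by rewrite !inE; case: eqVneq => // ->; rewrite iu.
have ui : u i = 0%N by apply/eqP; rewrite cmE_eq0.
have -> : act u (finsupp u) t = act u (i :: finsupp u) t by rewrite /= ui.
apply: act_perm => //.
apply: uniq_perm; rewrite /= ?fset_uniq ?iu // => j.
by rewrite !inE.
Qed.
End MultisetAction.

Lemma cmonom_ext (I : choiceType) (u v : {cmonom I}) :
  (forall i, u i = v i) -> u = v.
Proof. by move=> uv; apply/eqP/cmP. Qed.

Section Facts.
Context (R : realType) (L : euclideanLattice R).
Local Notation C := (Cplx R).
Local Notation bvec := (@bvec R L).
Local Notation vcoef x v := (mcoeff x (vmalg v)).

Lemma vmalg_linear : linear (@vmalg R L).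
Proof. exact: linearP. Qed.

HB.instance Definition _ :=
  GRing.isLinear.Build C (VL L) {malg C[pbw L]} _ (@vmalg R L) vmalg_linear.

Lemma vmalg_inj : injective (@vmalg R L).
Proof. exact: bij_inj (to_malg_bij _). Qed.

Lemma vmalg_bvec x : vmalg (bvec x) = << x >>.
Proof. exact: to_malg_vec. Qed.

Lemma bvec_coef x y : vcoef y (bvec x) = (x == y)%:R :> C.
Proof. rewrite vmalg_bvec; exact: mcoeffU. Qed.

Lemma bvec_supp x : msupp (vmalg (bvec x)) = [fset x]%fset.
Proof. by rewrite vmalg_bvec msuppU oner_eq0. Qed.

Lemma vcoefP x c (v w : VL L) : vcoef x (c *: v + w) = c * vcoef x v + vcoef x w.
Proof. by rewrite linearP mcoeffD mcoeffZ. Qed.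

Lemma VL_sum (v : VL L) : v = \sum_(x <- msupp (vmalg v)) vcoef x v *: bvec x.
Proof.
apply: vmalg_inj; rewrite {1}(monalgE (vmalg v)) linear_sum.
apply: eq_bigr => x _; rewrite linearZ /= vmalg_bvec.
by apply/malgP => y; rewrite mcoeffZ [LHS]mcoeffU [in RHS]mcoeffU mulr_natr.
Qed.

Lemma VL_ind (P : VL L -> Prop) :
  P 0 -> (forall c v w, P v -> P w -> P (c *: v + w)) ->
  (forall x, P (bvec x)) -> forall v, P v.
Proof.
move=> P0 PD P1 v; rewrite (VL_sum v); elim: (X in \sum_(k <- X) _) => [|k s IH].
  by rewrite big_nil.
rewrite big_cons; exact: (PD _ _ _ (P1 k) IH).
Qed.

Lemma lext_linear (W : lmodType C) (f : pbw L -> W) :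
  linear (fun v : VL L => \sum_(x <- msupp (vmalg v)) vcoef x v *: f x).
Proof.
move=> c v w.
have ext (x : {malg C[pbw L]}) (d : {fset pbw L}) : (msupp x `<=` d)%fset ->
    \sum_(k <- msupp x) mcoeff k x *: f k = \sum_(k <- d) mcoeff k x *: f k.
  move=> le; apply: big_fset_incl => // k _ kx.
  by rewrite mcoeff_outdom // scale0r.
have vwE x := vcoefP x c v w.
set d := (msupp (vmalg v) `|` msupp (vmalg w))%fset.
have sub : (msupp (vmalg (c *: v + w)) `<=` d)%fset.
  apply/fsubsetP => x; rewrite in_fsetU; apply: contraTT; rewrite negb_or.
  rewrite -!mcoeff_eq0 vwE => /andP[/eqP -> /eqP ->].
  by rewrite mulr0 addr0.
rewrite (ext _ _ sub) (ext _ d (fsubsetUl _ _)) (ext _ d (fsubsetUr _ _)).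
rewrite scaler_sumr -big_split /=; apply: eq_bigr => k _.
by rewrite vwE scalerDl scalerA.
Qed.

Lemma linext_linear f : linear (@linext R L f).
Proof. exact: lext_linear. Qed.

HB.instance Definition _ f :=
  GRing.isLinear.Build C (VL L) (VL L) _ (linext f) (linext_linear f).

Lemma linext1 f x : linext f (bvec x) = f x :> VL L.
Proof.
by rewrite /linext bvec_supp big_seq_fset1 bvec_coef eqxx scale1r.
Qed.

HB.instance Definition _ i := GRing.Linear.copy (@create R L i) (linext _).
HB.instance Definition _ i := GRing.Linear.copy (@annihilate R L i) (linext _).

Lemma create1 i x : create i (bvec x) = bvec (mmul (ucm i) x.1, x.2).
Proof. exact: linext1. Qed.

Lemma annihilate1 i x : annihilate i (bvec x) =
  (x.1 i)%:R *: bvec (divcm x.1 (ucm i), x.2).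
Proof. exact: linext1. Qed.

Lemma heis_linear h m : linear (@heis R L h m).
Proof.
move=> c v w; case: m => [[|k]|k] /=; first exact: linearP.
  rewrite scaler_sumr -big_split /=; apply: eq_bigr => i _.
  by rewrite linearP scalerDr !scalerA mulrC.
rewrite scaler_sumr -big_split /=; apply: eq_bigr => i _.
by rewrite linearP scalerDr !scalerA mulrC.
Qed.

HB.instance Definition _ h m :=
  GRing.isLinear.Build C (VL L) (VL L) _ (heis h m) (heis_linear h m).

Lemma cdot_linearl k : linear_for *%R (fun h => @cdot R L h k).
Proof.
move=> c h h'; rewrite /cdot mulr_sumr -big_split /=; apply: eq_bigr => i _.
rewrite mulr_sumr -big_split /=; apply: eq_bigr => j _.
by rewrite !mxE mulrDl mulrDl !mulrA.
Qed.

Lemma cdotC h k : @cdot R L h k = cdot k h.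
Proof.
rewrite /cdot exchange_big /=; apply: eq_bigr => i _; apply: eq_bigr => j _.
have -> : edot L (lbasis L)`_j (lbasis L)`_i = edot L (lbasis L)`_i (lbasis L)`_j.
  by rewrite hermC /= expr0 mul1r.
by rewrite [_ * k _ _]mulrC.
Qed.

Lemma heis_linearl m v : linear (fun h : cartan L => heis h m v).
Proof.
move=> c h h'; case: m => [[|k]|k] /=.
- rewrite /linext scaler_sumr -big_split /=; apply: eq_bigr => x _.
  rewrite cdot_linearl.
  rewrite scalerDl.
  rewrite scalerDr.
  congr (_ + _).
  rewrite !scalerA.
  by rewrite mulrCA mulrA.
- rewrite scaler_sumr -big_split /=; apply: eq_bigr => i _.
  by rewrite cdot_linearl mulrDr scalerDl !scalerA mulrCA.
- rewrite scaler_sumr -big_split /=; apply: eq_bigr => i _.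
  by rewrite !mxE scalerDl scalerA.
Qed.

Lemma cartan_sum (h : cartan L) : h = \sum_i (h : 'rV_(lrank L)) 0 i *: cartan_basis i.
Proof. exact: row_sum_delta. Qed.

Lemma cdot_sum h k : cdot h k = \sum_(i < lrank L) (k : 'rV_(lrank L)) 0 i * cdot h (cartan_basis i).
Proof.
rewrite cdotC {1}/cdot; apply: eq_bigr => i _.
rewrite [cdot h _]cdotC /cdot [in RHS](bigD1 i) //= [X in _ * (_ + X)]big1 ?addr0.
  rewrite mulr_sumr; apply: eq_bigr => j _.
  by rewrite mxE !eqxx mul1r mulrA.
move=> j ji; apply: big1 => l _; rewrite mxE (negPf ji) andbF !mul0r //.
Qed.

Lemma annihilate_create i j v : annihilate i (create j v) =
  create j (annihilate i v) + (i == j)%:R *: v :> VL L.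
Proof.
move: v; apply: VL_ind => [|c v w IHv IHw|[u a]].
- by rewrite !linear0 addr0.
- by rewrite !linearP /= IHv IHw !scalerDr !scalerA [c * _]mulrC addrACA.
- rewrite create1 annihilate1 annihilate1 linearZ /= create1 /=.
  rewrite cmM cmU natrD scalerDl addrC eq_sym; congr (_ + _).
    have [->|ui] := eqVneq (u i) 0%N; first by rewrite !scale0r.
    congr (_ *: bvec (_, _)); apply/cmonom_ext => k.
    rewrite divcmE !cmM divcmE !cmU addnBA //.
    by case: eqVneq => // <-; rewrite lt0n.
  have [->|ij] := eqVneq j i; last by rewrite !scale0r.
  rewrite !scale1r; congr (bvec (_, _)); apply/cmonom_ext => k.
  by rewrite divcmE cmM addKn.
Qed.

Lemma createC i j v : create i (create j v) = create j (create i v) :> VL L.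
Proof.
move: v; apply: VL_ind => [|c v w IHv IHw|[u a]].
- by rewrite !linear0.
- by rewrite !linearP /= IHv IHw.
- by rewrite !create1 /= !mulmA [mmul (ucm i) _]mulmC.
Qed.

Lemma annihilateC i j v :
  annihilate i (annihilate j v) = annihilate j (annihilate i v) :> VL L.
Proof.
move: v; apply: VL_ind => [|c v w IHv IHw|[u a]].
- by rewrite !linear0.
- by rewrite !linearP /= IHv IHw.
- rewrite !annihilate1 !linearZ /= !annihilate1 /= !scalerA.
  rewrite !divcmE !cmU -!natrM [(j == i)]eq_sym.
  have -> : divcm (divcm u (ucm j)) (ucm i) = divcm (divcm u (ucm i)) (ucm j).
    by apply/cmonom_ext => k; rewrite !divcmE subnAC.
  have [->//|ij] := eqVneq i j.
  by rewrite !subn0 mulnC.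
Qed.

Lemma comm_sum (n : nat) (f g : 'I_n -> {linear VL L -> VL L}) (a b : 'I_n -> C) v :
  (\sum_i a i *: f i (\sum_j b j *: g j v)) - (\sum_j b j *: g j (\sum_i a i *: f i v))
  = \sum_i \sum_j (a i * b j) *: (f i (g j v) - g j (f i v)).
Proof.
rewrite (eq_bigr (fun i => \sum_j (a i * b j) *: f i (g j v))); last first.
  move=> i _; rewrite linear_sum scaler_sumr; apply: eq_bigr => j _.
  by rewrite linearZ scalerA.
rewrite [X in _ - X](eq_bigr (fun j => \sum_i (a i * b j) *: g j (f i v))); last first.
  move=> j _; rewrite linear_sum scaler_sumr; apply: eq_bigr => i _.
  by rewrite linearZ scalerA mulrC.
rewrite [X in _ - X]exchange_big -sumrB; apply: eq_bigr => i _.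
by rewrite -sumrB; apply: eq_bigr => j _; rewrite scalerBr.
Qed.

Lemma heis_posE h n v : heis h n.+1 v =
  \sum_(i < lrank L) (n.+1%:R * cdot h (cartan_basis i)) *: annihilate (i, n) v.
Proof. by []. Qed.

Lemma heis_negE h n v : heis h (Negz n) v =
  \sum_(i < lrank L) (h : 'rV_(lrank L)) 0 i *: create (i, n) v.
Proof. by []. Qed.

#[local] Arguments heis : simpl never.

Lemma heis0_bvec h x : heis h 0 (bvec x) = cdot h (cartan_of_lat x.2) *: bvec x.
Proof. exact: linext1. Qed.

Lemma heis0_create h i v : heis h 0 (create i v) = create i (heis h 0 v) :> VL L.
Proof.
move: v; apply: VL_ind => [|c v w IHv IHw|x].
- by rewrite !linear0.
- by rewrite !linearP /= IHv IHw.
- by rewrite create1 !heis0_bvec linearZ /= create1.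
Qed.

Lemma heis0_annihilate h i v :
  heis h 0 (annihilate i v) = annihilate i (heis h 0 v) :> VL L.
Proof.
move: v; apply: VL_ind => [|c v w IHv IHw|x].
- by rewrite !linear0.
- by rewrite !linearP /= IHv IHw.
- by rewrite annihilate1 linearZ /= !heis0_bvec [annihilate i _]linearZ /= annihilate1 !scalerA mulrC.
Qed.

Lemma heis0C h k v : heis h 0 (heis k 0 v) = heis k 0 (heis h 0 v) :> VL L.
Proof.
move: v; apply: VL_ind => [|c v w IHv IHw|x].
- by rewrite !linear0.
- by rewrite !linearP /= IHv IHw.
- by rewrite !heis0_bvec ![heis _ 0 (_ *: _)]linearZ /= !heis0_bvec !scalerA mulrC.
Qed.

Lemma heis0_comm h k n (v : VL L) : heis h 0 (heis k n v) = heis k n (heis h 0 v).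
Proof.
case: n => [[|n]|n]; first exact: heis0C.
- rewrite !heis_posE linear_sum; apply: eq_bigr => i _.
  by rewrite linearZ /= heis0_annihilate.
- rewrite !heis_negE linear_sum; apply: eq_bigr => i _.
  by rewrite linearZ /= heis0_create.
Qed.

Lemma heis_pos_neg h k m n (v : VL L) :
  heis h m.+1 (heis k (Negz n) v) - heis k (Negz n) (heis h m.+1 v) =
  if m == n then (m.+1%:R * cdot h k) *: v else 0.
Proof.
rewrite ?heis_posE ?heis_negE (comm_sum (fun i => annihilate (i, m)) (fun j => create (j, n))
  (fun i => m.+1%:R * cdot h (cartan_basis i)) (fun j => (k : 'rV_(lrank L)) 0 j)).
have [<-|mn] := eqVneq m n; last first.
  rewrite big1 // => i _; rewrite big1 // => j _; rewrite /= annihilate_create addrC addKr.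
  by rewrite xpair_eqE (negPf mn) andbF scale0r scaler0.
rewrite cdot_sum mulr_sumr scaler_suml; apply: eq_bigr => i _.
rewrite (bigD1 i) //= big1 ?addr0 => [|j ji].
  by rewrite /= annihilate_create addrC addKr eqxx scale1r -mulrA [cdot _ _ * _]mulrC.
rewrite /= annihilate_create addrC addKr xpair_eqE eqxx andbT eq_sym (negPf ji).
by rewrite scale0r scaler0.
Qed.

Lemma heis_comm h k m n (v : VL L) :
  heis h m (heis k n v) - heis k n (heis h m v) =
  if m + n == 0 then (m%:~R * cdot h k) *: v else 0.
Proof.
have [->|m0] := eqVneq m 0.
  by rewrite heis0_comm subrr mul0r scale0r if_same.
have [->|n0] := eqVneq n 0.
  by rewrite -heis0_comm subrr addr0 (negPf m0).
case: m m0 => [[//|m]|m] _; case: n n0 => [[//|n]|n] _.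
- rewrite ?heis_posE ?heis_negE (comm_sum (fun i => annihilate (i, m)) (fun j => annihilate (j, n))
    (fun i => m.+1%:R * cdot h (cartan_basis i))
    (fun j => n.+1%:R * cdot k (cartan_basis j))).
  rewrite big1 // => i _; rewrite big1 // => j _.
  by rewrite /= annihilateC subrr scaler0.
- rewrite heis_pos_neg NegzE subr_eq0 eqz_nat eqSS.
  by case: eqP => // ->.
- rewrite -[LHS]opprB heis_pos_neg NegzE addrC subr_eq0 eqz_nat eqSS.
  case: eqP => [->|]; last by rewrite oppr0.
  by rewrite cdotC -scaleNr mulrNz mulNr.
- rewrite ?heis_posE ?heis_negE (comm_sum (fun i => create (i, m)) (fun j => create (j, n))
    (fun i => (h : 'rV_(lrank L)) 0 i) (fun j => (k : 'rV_(lrank L)) 0 j)).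
  rewrite big1 // => i _; rewrite big1 // => j _.
  by rewrite /= createC subrr scaler0.
Qed.

Lemma heis0_expL h (a : L) : heis h 0 (expL a) = cdot h (cartan_of_lat a) *: expL a.
Proof. exact: heis0_bvec. Qed.

Lemma heis_pos_expL h n (a : L) : heis h n.+1 (expL a) = 0.
Proof.
rewrite heis_posE big1 // => i _.
by rewrite annihilate1 cm1 scale0r scaler0.
Qed.

Lemma fock_ind (a : L) (P : VL L -> Prop) :
  P 0 -> (forall c v w, P v -> P w -> P (c *: v + w)) -> P (expL a) ->
  (forall i v, VM [set a] v -> P v -> P (create i v)) ->
  forall v, VM [set a] v -> P v.
Proof.
move=> P0 PD Pa Pc v av.
have Pb u : P (bvec (u, a)).
  have [n] := ubnP (mdeg u); elim: n u => // n IH u.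
  have [-> _|/negPf u1] := eqVneq u mone; first exact: Pa.
  have [i iu] : exists i, i \in finsupp u.
    apply/fset0Pn; apply: contraFneq u1 => u0; apply/eqP/cmonom_ext => i.
    by rewrite cm1; apply/eqP; rewrite cmE_eq0 u0.
  have uE : u = mmul (ucm i) (divcm u (ucm i)).
    apply: cmonom_ext => k; rewrite cmM divcmE cmU subnKC //.
    by case: eqVneq => // <-; rewrite lt0n cmE_neq0.
  rewrite {1}uE mdegM mdegU add1n ltnS => /IH Pu.
  rewrite uE -(create1 i (divcm u (ucm i), a)).
  by apply: Pc => // x; rewrite bvec_supp inE => /eqP ->.
rewrite (VL_sum v) big_seq; elim/big_rec: _ => // -[u b] w /av /= -> Pw.
exact: PD.
Qed.

Lemma createE i k v : create (i, k) v = heis (cartan_basis i) (Negz k) v :> VL L.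
Proof.
rewrite heis_negE (bigD1 i) //= big1 ?addr0 => [|j ji]; rewrite mxE.
  by rewrite !eqxx scale1r.
by rewrite (negPf ji) andbF scale0r.
Qed.

(* The span of the vectors bvec (u, a) is the module induced from the
   one-dimensional representation e^a of the nonnegative part of the Heisenberg
   algebra: it is universal among the modules with a vector w satisfying the
   relations of e^a (K being central, it acts as 1 on the submodule generated
   by such a w). *)
Lemma fock_universal (a : L) (W : lmodType C) (w : W)
    (rho : cartan L -> int -> W -> W) :
  (forall m u, linear (fun h => rho h m u)) ->
  (forall h m, linear (rho h m)) ->
  (forall h k m n u, rho h m (rho k n u) - rho k n (rho h m u) =
    if m + n == 0 then (m%:~R * cdot h k) *: u else 0) ->
  (forall h, rho h 0 w = cdot h (cartan_of_lat a) *: w) ->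
  (forall h n, rho h n.+1 w = 0) ->
  let intertwines (f : {linear VL L -> W}) := f (expL a) = w /\
    forall h m v, VM [set a] v -> f (heis h m v) = rho h m (f v) in
  exists2 f, intertwines f &
    forall g, intertwines g -> forall v, VM [set a] v -> g v = f v.
Proof.
move=> rhoDl rhoD rhoC rho0 rhoS intertwines.
pose op ik := rho (cartan_basis ik.1) (Negz ik.2).
have opC ik jl u : op ik (op jl u) = op jl (op ik u).
  by apply/eqP; rewrite -subr_eq0 rhoC.
pose F (x : pbw L) : W := foldr (fun ik => iter (x.1 ik) (op ik)) w (finsupp x.1).
pose f0 (v : VL L) := \sum_(x <- msupp (vmalg v)) vcoef x v *: F x.
pose fL := GRing.isLinear.Build C (VL L) W _ f0 (lext_linear F).
pose f : {linear VL L -> W} := HB.pack f0 fL.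
pose rhoL h m : {linear W -> W} :=
  HB.pack (rho h m) (GRing.isLinear.Build C W W _ (rho h m) (rhoD h m)).
pose rhoLl m u : {linear cartan L -> W} :=
  HB.pack (fun h => rho h m u) (GRing.isLinear.Build C (cartan L) W _ (fun h => rho h m u) (rhoDl m u)).
have f1 x : f (bvec x) = F x.
  by rewrite /= /f0 bvec_supp big_seq_fset1 bvec_coef eqxx scale1r.
have fcreate i v : f (create i v) = op i (f v).
  move: v; apply: VL_ind => [|c v v' IHv IHw|x].
  - by rewrite !linear0; exact/esym/(linear0 (rhoL _ _)).
  - by rewrite !linearP IHv IHw; exact/esym/(linearP (rhoL _ _)).
  - rewrite create1 !f1 /F /=.
    exact: (@foldr_finsupp_ucm _ _ op (fun=> True)).
have fneg h n v : f (heis h (Negz n) v) = rho h (Negz n) (f v).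
  rewrite heis_negE linear_sum [in RHS](cartan_sum h) [RHS](linear_sum (rhoLl _ _)).
  apply: eq_bigr => i _; rewrite linearZ fcreate.
  exact/esym/(linearZ_LR (rhoLl _ _)).
have fa : f (expL a) = w.
  rewrite f1 /F /=.
  by rewrite mdom1.
have fh h m v : VM [set a] v -> f (heis h m v) = rho h m (f v).
  move=> av; move: v av h m; apply: fock_ind.
  - by move=> h m; rewrite !linear0; exact/esym/(linear0 (rhoL h m)).
  - move=> c v v' IHv IHv' h m.
    by rewrite !linearP IHv IHv'; exact/esym/(linearP (rhoL h m)).
  - move=> h [[|n]|n]; rewrite ?fneg // fa.
      by rewrite heis0_expL linearZ fa rho0.
    by rewrite heis_pos_expL linear0 rhoS.
  - move=> [i k] v _ IH h m; rewrite createE fneg.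
    have /eqP := heis_comm h (cartan_basis i) m (Negz k) v.
    rewrite subr_eq => /eqP ->; rewrite linearD fneg IH.
    have /eqP := rhoC h (cartan_basis i) m (Negz k) (f v).
    rewrite subr_eq => /eqP ->; congr (_ + _).
    by case: ifP => _; rewrite ?linear0 // linearZ.
exists f => // g [ga gh] v av.
move: v av; apply: fock_ind => [|c v v' IHv IHv'||[i k] v av IH].
- by rewrite !linear0.
- by rewrite !linearP IHv IHv'.
- by rewrite ga fa.
- by rewrite createE gh // fneg IH.
Qed.

End Facts.

(* Main.v *)
Require Import Defs.
From HB Require Import structures.
From mathcomp Require Import all_boot all_order all_algebra finmap.
From mathcomp Require Import boolp classical_sets fsbigop reals.
From mathcomp.multinomials Require Import monalg.
From mathcomp Require Import zify ring.

Set Implicit Arguments.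
Unset Strict Implicit.
Unset Printing Implicit Defensive.

Import Order.TTheory GRing.Theory Num.Theory.

Local Open Scope classical_set_scope.
Local Open Scope ring_scope.

(** Why the normalizer is no larger than V_M.  Let a normalize V_M, let g be a
    weight outside M, and let a_g be the component of a in M(1, g).  As 0 lies
    in M, the vectors h(-1)1 belong to V_M, and a_N h(-1)1 lies in V_M for all
    N >= 0.  The modes respect the L-grading, so the weight g part of it, which
    is (a_g)_N h(-1)1, must vanish for every h.

    Let N bound from above the numbers k + 1 for which some b_i(-k-1) occurs in
    a_g.  In Y(a_g, z) h(-1)1 the coefficient of z^(-N-1) is then the leading
    pole, and skew-symmetry of vertex operators predicts its value:
    (a_g)_N h(-1)1 = (-1)^(N+1) h(N) a_g ([leading_modes_Ypbw]).  It is derived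
    here from the definition of the fields as normally ordered products: the
    facts in [leading_modes] hold for Y(e^g, z) ([leading_modes_Yexp]) and
    survive the normally ordered product with a derivative of b_i(z)
    ([leading_modes_nop]), because commuting h(N) past b_i(-k-1) produces a term
    exactly when the new factor has the extremal pole.

    Hence h(N) a_g = 0 for all h, for N the least such bound.  If N = 0, this
    reads (h | g) a_g = 0; as the form is nondegenerate ([dual_basis]) and g is
    not 0, a_g = 0.  If N = k + 1, taking h dual to b_i shows that a_g is killed
    by every annihilation operator of level k, so that no b_i(-k-1) occurs in
    a_g, which contradicts the choice of N.

    Conversely V_M is closed under all modes because a field attached to e^a
    shifts the grading by a ([VM_Ypbw]); a parabolic-type submonoid is in
    particular a submonoid. *)

Lemma fsbig_only (T : choiceType) (V : zmodType) (A : set T) (F : T -> V) t0 :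
  A t0 -> (forall t, A t -> t <> t0 -> F t = 0) -> \sum_(t \in A) F t = F t0.
Proof.
move=> At0 F0.
rewrite -(fsbig_set1 +%R t0 F : \sum_(t \in [set t0]) F t = F t0).
apply/esym/fsbig_widen.
  by move=> _ ->.
by move=> t [At tt0]; exact: F0.
Qed.

Section Fock.
Context (R : realType) (L : euclideanLattice R).
Local Notation C := (Cplx R).
Local Notation V := (VL L).
Local Notation vcoef x v := (mcoeff x (vmalg v)).
#[local] Arguments heis : simpl never.

(** * The grading by L *)

Definition maps_VM (S T : set L) (f : V -> V) := forall v, VM S v -> VM T (f v).

Lemma VM_coefP (S : set L) (v : V) : VM S v <-> forall x, ~ S x.2 -> vcoef x v = 0.
Proof.
split=> Sv x; first by move=> Sx; apply: mcoeff_outdom; apply/negP => /Sv.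
by rewrite -mcoeff_neq0 => vx; apply: contrapT => /Sv vx0; rewrite vx0 eqxx in vx.
Qed.

Lemma VM0 (S : set L) : VM S (0 : V).
Proof. by apply/VM_coefP => x _; rewrite linear0 mcoeff0. Qed.

Lemma VMP (S : set L) c (v w : V) : VM S v -> VM S w -> VM S (c *: v + w).
Proof.
move=> /VM_coefP Sv /VM_coefP Sw; apply/VM_coefP => x Sx.
by rewrite vcoefP Sv // Sw // mulr0 addr0.
Qed.

Lemma VMD (S : set L) (v w : V) : VM S v -> VM S w -> VM S (v + w).
Proof. by rewrite -{2}(scale1r v); exact: VMP. Qed.

Lemma VMZ (S : set L) c (v : V) : VM S v -> VM S (c *: v).
Proof. by rewrite -(addr0 (c *: v)) => Sv; apply: VMP => //; exact: VM0. Qed.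

Lemma VM_sum (S : set L) (I : eqType) (r : seq I) (F : I -> V) :
  (forall i, i \in r -> VM S (F i)) -> VM S (\sum_(i <- r) F i).
Proof.
move=> SF; rewrite big_seq; apply: big_ind => //; first exact: VM0.
exact: VMD.
Qed.

(** A sum over a set with infinite support is 0 by convention, which lies in V_S. *)
Lemma VM_fsbig (S : set L) (I : choiceType) (A : set I) (F : I -> V) :
  (forall i, A i -> VM S (F i)) -> VM S (\sum_(i \in A) F i).
Proof.
move=> SF; apply: VM_sum => i.
by case: finite_supportP => // X XA _ _ /XA /SF.
Qed.

Lemma VM_bvec (S : set L) (x : pbw L) : S x.2 -> VM S (bvec x).
Proof. by move=> Sx y; rewrite bvec_supp inE => /eqP ->. Qed.

Lemma VM_linext (S T : set L) f :
  (forall x, S x.2 -> VM T (f x)) -> maps_VM S T (linext f).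
Proof. by move=> ST v Sv; apply: VM_sum => x /Sv Sx; apply: VMZ; exact: ST. Qed.

(** The zero vector is the only one supported on the empty set of weights; this
    gives f 0 = 0 for operators that are not known to be linear, as is the case
    for those defined by sums over infinite sets. *)
Lemma maps_VM_0 (f : V -> V) : (forall S, maps_VM S S f) -> f 0 = 0.
Proof.
move=> fS; have /VM_coefP f0 := fS set0 _ (@VM0 set0).
by apply: vmalg_inj; apply/malgP => x; rewrite f0 // linear0 mcoeff0.
Qed.

HB.instance Definition _ eps a :=
  GRing.Linear.copy (@translate R L eps a) (linext _).
HB.instance Definition _ a k := GRing.Linear.copy (@zpow R L a k) (linext _).

Lemma VM_heis S h m : maps_VM S S (heis h m).
Proof.
case: m => [[|k]|k] v Sv.
- by move: v Sv; apply: VM_linext => x Sx; apply: VMZ; exact: VM_bvec.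
- rewrite heis_posE; apply: VM_sum => i _; apply: VMZ.
  by move: v Sv; apply: VM_linext => x Sx; apply: VMZ; exact: VM_bvec.
- rewrite heis_negE; apply: VM_sum => i _; apply: VMZ.
  by move: v Sv; apply: VM_linext => x Sx; exact: VM_bvec.
Qed.

(** Differentiating k times shifts the modes by k and multiplies them by the
    polynomial factor written here as a product. *)
Lemma iter_dfieldE k (A : vfield L) n v : iter k (@dfield R L) A n v =
  (\prod_(i < k) (i%:Z - n))%:~R *: A (n - k%:Z) v.
Proof.
elim: k n => [|k IH] n; first by rewrite big_ord0 scale1r subr0.
rewrite iterS /dfield IH scalerA big_ord_recl sub0r -intrM.
rewrite -addrA -opprD -PoszD add1n; congr (((_ * _)%:~R) *: _).
by apply: eq_bigr => i _; rewrite lift0 opprB addrA intS [1 + _]addrC.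
Qed.

Lemma VM_divided_heis S k h n : maps_VM S S (divided_dfield k (heis_field h) n).
Proof.
by move=> v Sv; rewrite /divided_dfield iter_dfieldE; do 2 apply: VMZ; exact: VM_heis.
Qed.

Lemma VM_opser_exp S (A : opser L) :
  (forall k, maps_VM S S (A k)) -> forall k, maps_VM S S (opser_exp A k).
Proof.
move=> SA k v Sv; apply: VM_sum => j _; apply: VMZ.
move: {j}(nat_of_ord j) => j; elim: j k => [|j IH] k.
  by case: k => [|k] //; exact: VM0.
by apply: VM_sum => i _; apply: SA; exact: IH.
Qed.

Lemma VM_exp_minus S a k : maps_VM S S (@exp_minus R L a k).
Proof.
apply: VM_opser_exp => -[|n] v Sv; first exact: VM0.
by apply: VMZ; exact: VM_heis.
Qed.

Lemma VM_exp_plus S a k : maps_VM S S (@exp_plus R L a k).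
Proof.
apply: VM_opser_exp => -[|n] v Sv; first exact: VM0.
by apply: VMZ; exact: VM_heis.
Qed.

Lemma VM_nop S T (A B : vfield L) :
  (forall U n, maps_VM U U (A n)) -> (forall n, maps_VM S T (B n)) ->
  forall n, maps_VM S T (nop A B n).
Proof.
move=> UA STB n v Sv; apply: VMD; apply: VM_fsbig => m _.
  by apply: UA; exact: STB.
by apply: STB; exact: UA.
Qed.

(** Only the translation operator in the definition of the field of u e^a changes
    the second component of a basis vector, and it adds a. *)
Lemma VM_Ypbw eps S x n :
  maps_VM S [set b | S (b - x.2)] (@Ypbw R L eps x n).
Proof.
rewrite /Ypbw; elim: (finsupp x.1 : seq _) n => [|[i k] s IH] n /=.
  move=> v Sv; apply: VM_fsbig => -[[p q] k] _.
  apply: VM_exp_minus; apply: VM_exp_plus.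
  have : VM S (zpow x.2 k v).
    move: v Sv; apply: VM_linext => y Sy; case: ifP => _; last exact: VM0.
    exact: VM_bvec.
  move: (zpow _ _ _); apply: VM_linext => y Sy; apply: VMZ; apply: VM_bvec => /=.
  by rewrite addrC addKr.
elim: (x.1 (i, k)) n => [|d IHd] //= n.
by apply: VM_nop => // U m; exact: VM_divided_heis.
Qed.

(** Weights add up under the modes, and M is closed under addition. *)
Lemma VM_Y eps (M : set L) : submonoid M ->
  forall a v n, VM M a -> VM M v -> VM M (Y eps a n v).
Proof.
move=> [_ MD] a v n Ma Mv; apply: VM_sum => x /Ma Mx; apply: VMZ.
move=> y /(@VM_Ypbw eps M x n v Mv y) /= Myx.
by rewrite -(subrK x.2 y.2); exact: MD.
Qed.

(** * The fields applied to the vacuum and to h(-1)1 *)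

Lemma heis_nat_vac h (n : nat) : heis h n (vac L) = 0.
Proof.
case: n => [|n]; last exact: heis_pos_expL.
rewrite heis0_expL (_ : cdot _ _ = 0) ?scale0r //.
rewrite /cdot big1 // => i _; rewrite big1 // => j _.
by rewrite mxE mxE mulr0 mul0r.
Qed.

Definition heis_vac (h : cartan L) : V := heis h (-1) (vac L).

Lemma VM_heis_vac (S : set L) h : S 0 -> VM S (heis_vac h).
Proof. by move=> S0; apply: VM_heis; exact: VM_bvec. Qed.

Lemma heis_nat_heis_vac g h (n : nat) :
  heis g n (heis_vac h) = if n == 1%N then cdot g h *: vac L else 0.
Proof.
have /eqP := heis_comm g h n (-1) (vac L).
rewrite heis_nat_vac (linear0 (heis h (-1))) subr0 => /eqP ->.
by rewrite subr_eq0 eqz_nat; case: eqP => // ->; rewrite mul1r.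
Qed.

(** When products of two coefficients of A kill v, so do the higher powers of A,
    and the exponential series stops after its linear term. *)
Lemma opser_exp_sqr0 (A : opser L) k v :
  A 0%N v = 0 -> (forall i, A i 0 = 0) -> (forall i j, A i (A j v) = 0) ->
  opser_exp A k v = (if k is 0 then v else 0) + A k v.
Proof.
move=> A0v A0 AA.
(* The first power of A is A itself, as A has no constant term on v, and the
   higher powers vanish on v. *)
have it1 q : iter 1 (opserM A) (@opser1 R L) q v = A q v.
  rewrite /= /opserM big_ord_recr /= subnn big1 ?add0r // => i _.
  have /prednK <- : (0 < q - i)%N by rewrite subn_gt0.
  exact: A0.
have it2 j q : iter j.+2 (opserM A) (@opser1 R L) q v = 0.
  elim: j q => [|j IH] q; rewrite iterS; apply: big1 => i _.
    by rewrite it1.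
  by rewrite IH.
rewrite /opser_exp; case: k => [|k].
  by rewrite big_ord1 invr1 scale1r A0v addr0.
rewrite big_ord_recl [X in X + _]/= scaler0 add0r.
rewrite big_ord_recl [X in _ + X]big1 => [|i _].
  by rewrite it1 add0r addr0 invr1 scale1r.
by rewrite it2 scaler0.
Qed.

Lemma exp_minus0 a v : @exp_minus R L a 0 v = v.
Proof. by rewrite /exp_minus /opser_exp big_ord1 invr1 scale1r. Qed.

Lemma exp_minus_0 a p : @exp_minus R L a p 0 = 0.
Proof. by apply: maps_VM_0 => S; exact: VM_exp_minus. Qed.

Lemma exp_plus_expL (a b : L) c q :
  @exp_plus R L a q (c *: expL b) = if q is 0 then c *: expL b else 0.
Proof.
have A0 i : heis (cartan_of_lat a) i.+1 (c *: expL b) = 0.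
  by rewrite linearZ /= heis_pos_expL scaler0.
rewrite /exp_plus opser_exp_sqr0 //.
- by case: q => [|q]; rewrite ?addr0 // A0 scaler0 addr0.
- by case=> // i; rewrite linear0 scaler0.
- case=> // i [|j]; first by rewrite linear0 scaler0.
  by rewrite A0 !(scaler0, linear0).
Qed.

Lemma heis_pos_heis_expL g h (a : L) n : heis g n.+1 (heis h (-1) (expL a)) =
  if n == 0%N then cdot g h *: expL a else 0.
Proof.
have /eqP := heis_comm g h n.+1 (-1) (expL a).
rewrite heis_pos_expL (linear0 (heis h (-1))) subr0 => /eqP ->.
by rewrite subr_eq0 eqz_nat eqSS; case: eqP => // ->; rewrite mul1r.
Qed.

Lemma exp_plus_heis (a b : L) h q : @exp_plus R L a q (heis h (-1) (expL b)) =
  match q with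
  | 0 => heis h (-1) (expL b)
  | 1 => - cdot (cartan_of_lat a) h *: expL b
  | _ => 0
  end.
Proof.
rewrite /exp_plus opser_exp_sqr0 //.
- case: q => [|[|q]]; rewrite ?addr0 // add0r heis_pos_heis_expL.
    by rewrite invr1 scaleN1r scaleNr.
  by rewrite scaler0.
- by case=> // i; rewrite linear0 scaler0.
- case=> // i [|j]; first by rewrite linear0 scaler0.
  rewrite linearZ /= heis_pos_heis_expL.
  case: eqP => _; last by rewrite !(scaler0, linear0).
  by rewrite [heis _ i.+1 (_ *: expL b)]linearZ /= heis_pos_expL !scaler0.
Qed.

Lemma heis_neg_comm h n (f : {linear V -> V}) v :
  (forall ik w, f (create ik w) = create ik (f w)) ->
  f (heis h (Negz n) v) = heis h (Negz n) (f v).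
Proof.
move=> fC; rewrite !heis_negE linear_sum; apply: eq_bigr => i _.
by rewrite linearZ /= fC.
Qed.

Lemma translate_heis eps h n a v :
  @translate R L eps a (heis h (Negz n) v) = heis h (Negz n) (translate eps a v).
Proof.
apply: heis_neg_comm => ik w; move: w.
apply: VL_ind => [|c v' w IHv IHw|x].
- by rewrite !linear0.
- by rewrite !linearP /= IHv IHw.
- by rewrite create1 /= /translate !linext1 linearZ /= create1.
Qed.

Lemma zpow_heis h n a k v :
  @zpow R L a k (heis h (Negz n) v) = heis h (Negz n) (zpow a k v).
Proof.
apply: heis_neg_comm => ik w; move: w.
apply: VL_ind => [|c v' w IHv IHw|x].
- by rewrite !linear0.
- by rewrite !linearP /= IHv IHw.
- rewrite create1 /= /zpow !linext1 /=; case: ifP => _; last by rewrite linear0.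
  by rewrite create1.
Qed.

Lemma zpow_vac a k : zpow a k (vac L) = if k == 0 then vac L else 0.
Proof.
rewrite /vac /expL /zpow linext1 /=.
have -> : ldot a (0 : L) = 0.
  rewrite /ldot (_ : lvec 0 = 0) ?linear0r //.
  by rewrite /lvec big1 // => i _; rewrite mxE scale0r.
by rewrite -[0 in LHS]/(0%:~R) eqr_int eq_sym.
Qed.

Section Modes.
Context (eps : L -> L -> int) (epsP : sign_cocycle eps).

(** With epsilon(a, 0) = 1, translation by a turns the vacuum into e^a. *)
Lemma translate_vac a : translate eps a (vac L) = expL a.
Proof.
by rewrite /vac /expL /translate linext1 /= (sign_cocycle0r epsP) scale1r addr0.
Qed.

Lemma translate_heis_vac a h : translate eps a (heis_vac h) = heis h (-1) (expL a).
Proof. by rewrite translate_heis translate_vac. Qed.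

Lemma zpow_heis_vac a k h :
  zpow a k (heis_vac h) = if k == 0 then heis_vac h else 0.
Proof. by rewrite zpow_heis zpow_vac; case: ifP; rewrite ?linear0. Qed.

Lemma Yexp_terms0 a p q : exp_minus a p (exp_plus a q (translate eps a 0)) = 0.
Proof.
rewrite linear0 (_ : exp_plus a q 0 = 0) ?exp_minus_0 //.
by apply: maps_VM_0 => S; exact: VM_exp_plus.
Qed.

Lemma Yexp_0 a n : Yexp eps a n 0 = 0.
Proof.
by apply: fsbig1 => -[[p q] k] _; rewrite linear0; exact: Yexp_terms0.
Qed.

Lemma Yexp_vac_nat a c (n : nat) : Yexp eps a n (c *: vac L) = 0.
Proof.
apply: fsbig1 => -[[p q] k] /= tn; rewrite linearZ /= zpow_vac.
case: eqP => [k0|_]; last by rewrite scaler0 Yexp_terms0.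
rewrite linearZ /= translate_vac exp_plus_expL.
case: q tn => [|q] tn; last exact: exp_minus_0.
by move: tn; rewrite k0; lia.
Qed.

Lemma Yexp_vac_m1 a c : Yexp eps a (-1) (c *: vac L) = c *: expL a.
Proof.
rewrite /Yexp (fsbig_only (t0 := (0%N, 0%N, 0))) //=.
  rewrite linearZ /= zpow_vac linearZ /= translate_vac.
  by rewrite exp_plus_expL exp_minus0.
move=> [[p q] k] /= tn t0; rewrite linearZ /= zpow_vac.
case: eqP => [k0|_]; last by rewrite scaler0 Yexp_terms0.
rewrite linearZ /= translate_vac exp_plus_expL.
case: q tn t0 => [|q] tn t0; last exact: exp_minus_0.
case: t0; rewrite k0; congr (_, _, _); move: tn; rewrite k0; lia.
Qed.

(** Y(e^a, z) h(-1)1 has at most a simple pole, which comes from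
    exp(- sum a(n) z^(-n) / n) through [a(1), h(-1)] = (a | h). *)
Lemma Yexp_heis_vac a h (n : nat) : Yexp eps a n (heis_vac h) =
  if n == 0%N then - cdot (cartan_of_lat a) h *: expL a else 0.
Proof.
(* The only contribution to a nonnegative mode is the one of z^-1, from
   (p, q, k) = (0, 1, 0), and it belongs to the mode n = 0. *)
have F (t : nat * nat * int) : (let: (p, q, k) := t in p%:Z - q%:Z + k = - n%:Z - 1) ->
    t <> (0%N, 1%N, 0) \/ n <> 0%N ->
    (let: (p, q, k) := t in
     exp_minus a p (exp_plus a q (translate eps a (zpow a k (heis_vac h))))) = 0.
  move: t => [[p q] k] tn t0; rewrite zpow_heis_vac.
  case: eqP => [k0|_]; last exact: Yexp_terms0.
  rewrite translate_heis_vac exp_plus_heis; subst k.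
  case: q tn t0 => [|[|q]] tn t0; [lia| |exact: exp_minus_0].
  case: t0 => [[]|n0]; last by lia.
  by congr (_, _, _); lia.
case: eqP => [n0|/= n0]; last by apply: fsbig1 => t /F; apply; right.
rewrite /Yexp (fsbig_only (t0 := (0%N, 1%N, 0))) //=; last 1 first.
- by move=> t tn t0; apply: F => //; left.
- by rewrite zpow_heis_vac /= translate_heis_vac exp_plus_heis exp_minus0.
- by rewrite n0.
Qed.


(** * The leading pole on h(-1)1 *)

(** What an induction over normally ordered products has to carry along for the
    field B of a state v whose creation operators have level below N: creation
    of v from the vacuum, and skew-symmetry with h(-1)1 at the extremal mode N.
    Scalar multiples of the vacuum are included because a mode of a normally
    ordered product is a sum over an infinite index set, and so its linearity is
    not automatic. *)
Record leading_modes (h : cartan L) (N : nat) (B : vfield L) (v : V) : Prop :=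
  LeadingModes {
    mode_0 : forall n, B n 0 = 0;
    vac_regular : forall (n : nat) c, B n (c *: vac L) = 0;
    vac_state : forall c, B (-1) (c *: vac L) = c *: v;
    heis_vac_pole : forall n : nat, (N < n)%N -> B n (heis_vac h) = 0;
    heis_vac_leading : B N (heis_vac h) = (-1) ^+ N.+1 *: heis h N v }.

Lemma leading_modes_Yexp h N a : leading_modes h N (Yexp eps a) (expL a).
Proof.
split=> [n|n c|c|n Nn|]; first exact: Yexp_0.
- exact: Yexp_vac_nat.
- exact: Yexp_vac_m1.
- by rewrite Yexp_heis_vac; case: n Nn.
- rewrite Yexp_heis_vac; case: N => [|N] /=.
    by rewrite heis0_expL cdotC scaleN1r scaleNr.
  by rewrite heis_pos_expL scaler0.
Qed.

(** The derivative of order k has no mode between 0 and k - 1. *)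
Lemma prod_sub_nat k n : (n < k)%N -> \prod_(i < k) (i%:Z - n%:Z) = 0.
Proof. by move=> nk; rewrite (bigD1 (Ordinal nk)) //= subrr mul0r. Qed.

Lemma divided_heis_vac_nat g k c (n : nat) :
  divided_dfield k (heis_field g) n (c *: vac L) = 0.
Proof.
rewrite /divided_dfield iter_dfieldE; have [nk|kn] := ltnP n k.
  by rewrite prod_sub_nat // scale0r scaler0.
rewrite /heis_field subzn // [heis _ _ _]linearZ /=.
by rewrite heis_nat_vac !scaler0.
Qed.

Lemma natfact_neq0 k : (k`!%:R : C) != 0.
Proof. by rewrite pnatr_eq0 -lt0n fact_gt0. Qed.

(** The (-1)-st mode of the k-th divided derivative of b_i(z) creates b_i(-k-1):
    the polynomial factor of [iter_dfieldE] is k! at n = -1. *)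
Lemma divided_heis_m1 i k (v : V) :
  divided_dfield k (heis_field (cartan_basis i)) (-1) v = create (i, k) v.
Proof.
rewrite /divided_dfield iter_dfieldE /heis_field createE.
have -> : -1 - k%:Z = Negz k by rewrite NegzE; lia.
have -> : \prod_(j < k) (j%:Z - -1) = k`!%:Z.
  elim: k => [|k IH]; first by rewrite big_ord0.
  by rewrite big_ord_recr /= IH factS PoszM mulrC opprK -PoszD addn1.
by rewrite scalerA mulVf ?scale1r // natfact_neq0.
Qed.

Lemma prod_sub_natS k : \prod_(j < k) (j%:Z - k.+1%:Z) = (-1) ^+ k * (k.+1`!)%:Z.
Proof.
transitivity (\prod_(j < k) (- j.+2%:Z)).
  rewrite (reindex_inj rev_ord_inj); apply: eq_bigr => j _ /=.
  by have := ltn_ord j; lia.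
elim: k => [|k IH]; first by rewrite big_ord0 mulr1.
by rewrite big_ord_recr /= IH [k.+2`!]factS PoszM exprS; ring.
Qed.

(** Among the annihilation modes only n = k + 1, which is a multiple of g(1),
    acts on h(-1)1. *)
Lemma divided_heis_heis_vac g h k (n : nat) :
  divided_dfield k (heis_field g) n (heis_vac h) =
  if n == k.+1 then ((-1) ^+ k * (k.+1%:R * cdot g h)) *: vac L else 0.
Proof.
rewrite /divided_dfield iter_dfieldE /heis_field; have [nk|kn] := ltnP n k.
  by rewrite prod_sub_nat // scale0r scaler0 ltn_eqF // ltnW.
rewrite subzn // heis_nat_heis_vac.
have -> : (n - k == 1)%N = (n == k.+1) by lia.
case: eqP => [->|_]; last by rewrite !scaler0.
rewrite prod_sub_natS !scalerA; congr (_ *: _).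
rewrite intrM rmorphXn /= rmorphN1 factS PoszM intrM -!mulrA.
by rewrite mulrCA [_^-1 * _]mulrCA mulKf // natfact_neq0.
Qed.

(** Let A be the k-th divided derivative of b_i(z).  On h(-1)1, the mode n >= N
    of the normally ordered product of A and B has two sources: A_(-1) B_n, where
    A_(-1) = b_i(-k-1), and B_(n-k-2) A_(k+1), where A_(k+1) h(-1)1 is a multiple
    of the vacuum.  The second is nonzero only for n = N = k + 1, and then it is
    the commutator of h(N) with b_i(-k-1), up to the sign (-1)^(N+1). *)
Lemma leading_modes_nop h N i k B (v : V) : (k < N)%N -> leading_modes h N B v ->
  leading_modes h N (nop (divided_dfield k (heis_field (cartan_basis i))) B)
    (create (i, k) v).
Proof.
move=> kN [B0 Bn Bv Bh BN].
set A := divided_dfield _ _.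
have A0 n : A n 0 = 0 by apply: maps_VM_0 => S; exact: VM_divided_heis.
have Avac (m : int) c : 0 <= m -> A m (c *: vac L) = 0.
  by case: m => // m _; exact: divided_heis_vac_nat.
have {}Bn (n : int) c : 0 <= n -> B n (c *: vac L) = 0 by case: n.
have {}Bh (n : int) : N%:Z < n -> B n (heis_vac h) = 0.
  by case: n => // n Nn; apply: Bh; lia.
have Aheis (m : int) : 0 <= m -> A m (heis_vac h) =
    if m == k.+1 then
      ((-1) ^+ k * (k.+1%:R * cdot (cartan_basis i) h)) *: vac L
    else 0.
  by case: m => // m _; exact: divided_heis_heis_vac.
split.
- by move=> n; rewrite /nop !fsbig1 ?addr0 // => m _; rewrite ?B0 ?A0 ?B0.
- move=> n c; rewrite /nop !fsbig1 ?addr0 // => m /= m0.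
    by rewrite Avac // B0.
  by rewrite Bn ?A0 //; lia.
- move=> c; rewrite /nop (fsbig_only (t0 := -1)) //= => [|m m0 m1]; last first.
    by rewrite Bn ?A0 //; lia.
  rewrite fsbig1 ?addr0 => [|m /= m0]; last by rewrite Avac // B0.
  by rewrite (_ : -1 - -1 - 1 = -1) // Bv /A divided_heis_m1 linearZ.
- move=> n Nn; rewrite /nop !fsbig1 ?addr0 // => m /= m0.
    rewrite Aheis //; case: eqP => mk; last exact: B0.
    by rewrite Bn //; lia.
  by rewrite Bh ?A0 //; lia.
rewrite /nop (fsbig_only (t0 := -1)) //= => [|m m0 m1]; last first.
  by rewrite Bh ?A0 //; lia.
rewrite (_ : N%:Z - -1 - 1 = N) ?BN; last by lia.
rewrite {1}/A divided_heis_m1 linearZ /=.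
rewrite (fsbig_only (t0 := k.+1%:Z)) //= => [|m m0 mk]; last first.
  by rewrite Aheis //; case: eqP => // _; exact: B0.
(* It remains to compare B_(N-k-2) on the vacuum with [h(N), b_i(-k-1)] v. *)
rewrite Aheis // eqxx; case: N kN Bh BN => // N kN _ _.
have /eqP := heis_pos_neg h (cartan_basis i) N k v.
rewrite -createE subr_eq => /eqP ->; rewrite scalerDr addrC; congr (_ + _); last first.
  by rewrite createE.
have [<-|Nk] := eqVneq N k.
  rewrite (_ : N.+1%:Z - N.+1%:Z - 1 = -1); last by lia.
  rewrite Bv scalerA cdotC; congr (_ *: _).
  by rewrite !exprS !mulN1r opprK.
by rewrite scaler0 Bn //; lia.
Qed.

Lemma iter_create_bvec (ik : ('I_(lrank L) * nat)%type) n
    (u : {cmonom ('I_(lrank L) * nat)%type}) (a : L) :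
  exists2 v, iter n (create ik) (bvec (u, a)) = bvec (v, a) &
    forall jl, v jl = (n * (ik == jl) + u jl)%N.
Proof.
elim: n => [|n [v vE vu]]; first by exists u.
exists (mmul (ucm ik) v); first by rewrite iterS vE create1.
by move=> jl; rewrite cmM cmU vu mulSn addnA.
Qed.

Lemma foldr_create_bvec (u : {cmonom ('I_(lrank L) * nat)%type}) (a : L) :
  foldr (fun ik => iter (u ik) (create ik)) (expL a) (finsupp u) = bvec (u, a).
Proof.
have F (s : seq ('I_(lrank L) * nat)%type) : uniq s ->
    exists2 v : {cmonom ('I_(lrank L) * nat)%type},
    foldr (fun ik => iter (u ik) (create ik)) (expL a) s = bvec (v, a) &
    forall jl, v jl = if jl \in s then u jl else 0%N.
  elim: s => [_|ik s IH /= /andP[iks /IH[v -> vu]]].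
    by exists mone => // jl; rewrite cm1.
  have [w -> wv] := iter_create_bvec ik (u ik) v a; exists w => // jl.
  rewrite wv vu inE eq_sym; case: eqVneq => [->|_]; last by rewrite muln0.
  by rewrite (negPf iks) muln1 addn0.
have [v -> vu] := F _ (fset_uniq (finsupp u)); congr (bvec (_, _)).
apply: cmonom_ext => jl; rewrite vu; case: ifPn => // jlu.
by apply/esym/eqP; rewrite cmE_eq0.
Qed.

(** The leading term of skew-symmetry, (u e^a)_N h(-1)1 =
    (-1)^(N+1) h(N) u e^a, holds as soon as N exceeds all levels in u. *)
Lemma leading_modes_Ypbw h N (x : pbw L) :
  (forall ik, ik \in finsupp x.1 -> (ik.2 < N)%N) ->
  leading_modes h N (Ypbw eps x) (bvec x).
Proof.
case: x => u a /= uN.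
have {}uN ik : ik \in enum_fset (finsupp u) -> (ik.2 < N)%N by exact: uN.
rewrite -foldr_create_bvec /Ypbw /=.
elim: (enum_fset (finsupp u)) uN => [_|[i k] s IH sN] /=.
  exact: leading_modes_Yexp.
elim: (u (i, k)) => [|n IHn] /=.
  by apply: IH => ik iks; apply: sN; rewrite inE iks orbT.
by apply: leading_modes_nop IHn; apply: (sN (i, k)); rewrite mem_head.
Qed.

(** * The normalizer *)

Lemma vcoefZ x c (v : V) : vcoef x (c *: v) = c * vcoef x v.
Proof. by rewrite -[c *: v]addr0 vcoefP linear0 mcoeff0 addr0. Qed.

Lemma coef_sum_bvec (s : seq (pbw L)) (d : pbw L -> C) x : uniq s -> x \in s ->
  vcoef x (\sum_(y <- s) d y *: bvec y) = d x.
Proof.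
move=> us xs; rewrite (bigD1_seq x) //= linearD mcoeffD.
rewrite vcoefZ bvec_coef eqxx mulr1 linear_sum raddf_sum big1 ?addr0 // => y yx.
by rewrite [LHS]vcoefZ bvec_coef (negPf yx) mulr0.
Qed.

(** The product of b_i(-k-1) with the annihilation operator dual to it counts the
    occurrences of b_i(-k-1), so it detects them. *)
Lemma create_annihilate ik (x : pbw L) :
  create ik (annihilate ik (bvec x)) = (x.1 ik)%:R *: bvec x.
Proof.
rewrite annihilate1 linearZ /= create1 /=.
have [->|xik] := eqVneq (x.1 ik) 0%N; first by rewrite !scale0r.
congr (_ *: _); case: x xik => u a /= uik; congr (bvec (_, _)).
apply: cmonom_ext => jl; rewrite cmM divcmE cmU subnKC //.
by case: eqVneq => // <-; rewrite lt0n.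
Qed.

(** The Gram matrix of an R-basis is invertible, so the bilinear form on the
    Cartan space has a basis dual to that of the lattice. *)
Lemma dual_basis (i : 'I_(lrank L)) :
  exists h : cartan L, forall k, cdot h k = (k : 'rV_(lrank L)) 0 i.
Proof.
pose G := \matrix_(i, j) edot L (lbasis L)`_i (lbasis L)`_j : 'M[R]_(lrank L).
have Gu : G \in unitmx.
  rewrite -row_free_unit -kermx_eq0; apply/eqP/row_matrixP => j.
  rewrite row0; set v := row j _.
  have vG : v *m G = 0.
    by apply/sub_kermxP; exact: row_sub.
  (* A vector v in the kernel of G has norm v G v^T = 0. *)
  pose e := \sum_i v 0 i *: (lbasis L)`_i.
  have e0 : e = 0.
    apply/eqP; apply: contraT => /(neq0_dnorm_gt0 (s := edot L)).
    suff -> : edot L e e = 0 by rewrite ltxx.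
    rewrite {2}/e linear_sumr big1 // => k _.
    rewrite linearZr_LR /= /e linear_sumlz.
    under eq_bigr do rewrite linearZl_LR /=.
    have -> : \sum_i v 0 i * edot L (lbasis L)`_i (lbasis L)`_k = (v *m G) 0 k.
      by rewrite [RHS]mxE; apply: eq_bigr => l _; rewrite [G _ _]mxE.
    by rewrite vG [X in _ * X]mxE mulr0.
  apply/rowP => k; rewrite [RHS]mxE.
  exact: (freeP (basis_free (lbasisP L)) (fun i => v 0 i) e0 k).
pose H : 'M[C]_(lrank L) := invmx (map_mx (@toC R) G).
exists (row i H : 'rV_(lrank L)) => k.
rewrite /cdot exchange_big.
have HG : H *m map_mx (@toC R) G = 1%:M by rewrite mulVmx ?map_unitmx.
transitivity ((H *m map_mx (@toC R) G *m (k : 'rV_(lrank L))^T) i 0).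
  rewrite [RHS]mxE; apply: eq_bigr => j _; rewrite [(_ *m _) _ _]mxE mulr_suml.
  by apply: eq_bigr => l _; rewrite !mxE -!mulrA [k _ _ * _]mulrC.
by rewrite HG mul1mx mxE.
Qed.

Lemma heis_dual (h : cartan L) i k (v : V) :
  (forall g, cdot h g = (g : 'rV_(lrank L)) 0 i) ->
  heis h k.+1 v = k.+1%:R *: annihilate (i, k) v.
Proof.
move=> hi; rewrite heis_posE (bigD1 i) //= big1 ?addr0 => [|j ji]; rewrite hi mxE.
  by rewrite !eqxx mulr1.
by rewrite eq_sym (negPf ji) andbF mulr0 scale0r.
Qed.

Lemma normalizer_VM_sub (M : set L) : submonoid M ->
  normalizer (Y eps) (VM M) `<=` VM M.
Proof.
move=> [M0 _] a Na x xa; apply: contrapT => Mx; set g := x.2 in Mx.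
pose s := [seq y <- msupp (vmalg a) | y.2 == g].
pose ag : V := \sum_(y <- s) vcoef y a *: bvec y.
have us : uniq s by rewrite filter_uniq // fset_uniq.
have xs : x \in s by rewrite mem_filter eqxx.
have ca y : y \in s -> vcoef y a != 0.
  by rewrite mem_filter mcoeff_neq0 => /andP[].
have sg y : y \in s -> y.2 = g by rewrite mem_filter => /andP[/eqP].
have agg : VM [set g] ag.
  apply: VM_sum => y /sg yg; apply: VMZ; exact: VM_bvec.
pose N := (\max_(y <- s) \max_(ik <- finsupp y.1) ik.2.+1)%N.
have sN y ik : y \in s -> ik \in finsupp y.1 -> (ik.2 < N)%N.
  move=> ys yik; rewrite /N (big_rem y) //= leq_max.
  by rewrite (big_rem ik) //= leq_max leqnn.
(* The weight g part of Y(a)_N h(-1)1 is +- h(N) ag, the rest r has no weight g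
   component, and the sum lies in V_M with g not in M. *)
have hag h : heis h N ag = 0.
  have Mw : VM M (heis_vac h) by exact: VM_heis_vac.
  have /VM_coefP MY := Na N _ Mw.
  pose r := \sum_(y <- msupp (vmalg a) | y.2 != g)
    vcoef y a *: Ypbw eps y N (heis_vac h).
  have /VM_coefP rg : VM [set~ g] r.
    rewrite /r -big_filter; apply: VM_sum => y.
    rewrite mem_filter => /andP[yg _]; apply: VMZ.
    move=> z /(@VM_Ypbw eps [set 0] y N _ (@VM_heis_vac [set 0] h erefl) z) /= zy zg.
    by move/eqP: yg; apply; rewrite -zg; apply/esym/eqP; rewrite -subr_eq0 zy.
  have YE : Y eps a N (heis_vac h) = (-1) ^+ N.+1 *: heis h N ag + r.
    rewrite /Y (bigID (fun y => y.2 == g)) /=; congr (_ + _).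
    rewrite -big_filter -/s /ag linear_sum scaler_sumr; apply: eq_big_seq => y ys.
    rewrite (heis_vac_leading (leading_modes_Ypbw h (fun ik => sN y ik ys))).
    by rewrite [X in _ = _ *: X]linearZ /= !scalerA mulrC.
  suff : (-1) ^+ N.+1 *: heis h N ag = 0.
    by move/eqP; rewrite scaler_eq0 signr_eq0 => /eqP.
  apply: vmalg_inj; apply/malgP => z; rewrite linear0 mcoeff0.
  have [zg|zg] := pselect (z.2 = g); last first.
    have /VM_coefP hg : VM [set g] (heis h N ag) by exact: VM_heis.
    by rewrite vcoefZ hg ?mulr0.
  have := MY z; rewrite zg YE linearD mcoeffD (rg z) ?addr0; first exact.
  by move=> /(_ zg).
have agx : vcoef x ag != 0 by rewrite coef_sum_bvec ?ca.
(* Without creation operators, h(0) multiplies ag by (h | g); with them, some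
   b_i(-k-1) attains the maximal level k = N - 1. *)
case NE : N hag => [|k] hag.
  have g0 : g = 0.
    apply/rowP => i; rewrite [RHS]mxE; apply/eqP; rewrite -(intr_eq0 C).
    have [h hi] := dual_basis i; have := hag h.
    have -> : heis h 0 ag = cdot h (cartan_of_lat g) *: ag.
      rewrite /ag linear_sum scaler_sumr; apply: eq_big_seq => y ys.
      by rewrite linearZ /= heis0_bvec sg // !scalerA mulrC.
    rewrite hi mxE => hg0; apply: contraNT agx => gi.
    by move/eqP: hg0; rewrite scaler_eq0 (negPf gi) => /eqP ->; rewrite linear0 mcoeff0.
  by apply: Mx; rewrite g0.
have [y ys [ik yik ikk]] :
    exists2 y, y \in s & exists2 ik, ik \in finsupp y.1 & ik.2 = k.
  apply: contrapT => nN.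
  suff : (N <= k)%N by rewrite NE ltnn.
  rewrite /N; apply/bigmax_leqP_seq => y ys _; apply/bigmax_leqP_seq => ik yik _.
  have := sN y ik ys yik; rewrite NE ltnS leq_eqVlt => /orP[/eqP ikk|//].
  by case: nN; exists y => //; exists ik.
case: ik yik ikk => i l /= yik lk; subst l.
have [h hi] := dual_basis i.
have := congr1 (create (i, k)) (hag h); rewrite (heis_dual _ _ hi) linearZ linear0 /=.
move/eqP; rewrite scaler_eq0 pnatr_eq0 /= => /eqP.
have -> : create (i, k) (annihilate (i, k) ag) =
    \sum_(y <- s) (vcoef y a * (y.1 (i, k))%:R) *: bvec y.
  rewrite /ag (linear_sum (annihilate (i, k))) (linear_sum (create (i, k))).
  apply: eq_bigr => z _.
  by rewrite !linearZ /= create_annihilate scalerA.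
move=> /(congr1 (fun v => vcoef y v)); rewrite coef_sum_bvec // linear0 mcoeff0.
move/eqP; rewrite mulf_eq0 (negPf (ca _ ys)) pnatr_eq0 /=.
by rewrite cmE_eq0 yik.
Qed.

Lemma normalizer_VM (M : set L) : submonoid M ->
  normalizer (Y eps) (VM M) = VM M.
Proof.
move=> Mm; apply/seteqP; split; first exact: normalizer_VM_sub.
by move=> a Ma j w Mw; exact: VM_Y.
Qed.

End Modes.
End Fock.

Theorem proposition4p8 (R : realType) (L : euclideanLattice R)
    (eps : L -> L -> int) (Leven : even_lattice L) (epsP : sign_cocycle eps) :
  (forall M : set L, submonoid M -> normalizer (Y eps) (VM M) = VM M) /\
  (forall P : set L, parabolic_type P -> normalizer (Y eps) (VM P) = VM P).
Proof.
split=> [M Mm|P [Pm _]]; exact: normalizer_VM.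
Qed.
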